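(* Let $p\in\mathbb{N}$, $p>1$, and let $f(z)=\sin(1/z^{p-1})$ for $z\in\mathbb{C}\setminus\{0\}$. Then for any $c>1$ there exists $\gamma>0$ such that $$\sup_{z\in\mathcal D^p_\gamma}|f(z)|\leqslant c\cdot\sup_{x\in[-1,1]}|f(x)|.$$ Therefore, for any $\alpha<\beta$ in $[-1,1]$, $$\varrho(\alpha,\beta)\subset\mathcal D^p_\gamma\ \Longrightarrow\ f\text{ is analytic on }\varrho(\alpha,\beta)\ \text{ and }\ \sup_{z\in\varrho(\alpha,\beta)}|f(z)|\leqslant c\cdot\sup_{x\in[-1,1]}|f(x)|.$$
   Context: $\mathcal D^p_\gamma=\{x+iy: |y|\leqslant\gamma|x|^p\}$ for $\gamma>0$. For a fixed $A>1$ and $B=\sqrt{A^2-1}$, and real $\alpha<\beta$, $\varrho(\alpha,\beta)=\{x+iy: |x-\frac{\alpha+\beta}{2}|\leqslant A\frac{\beta-\alpha}{2},\ |y|\leqslant B\frac{\beta-\alpha}{2}\}$. All suprema of $|f|$ are taken over the points of the indicated set lying in the domain $\mathbb{C}\setminus\{0\}$ of $f$. *)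

(* Defs.v *)
(* Stdlib reals with Coquelicot's complex numbers. *)
From Stdlib Require Import Reals.
From Coquelicot Require Import Coquelicot.
Open Scope R_scope.

Definition Cexp (w : C) : C :=
  (RtoC (exp (Re w)) * (RtoC (cos (Im w)) + Ci * RtoC (sin (Im w))))%C.

Definition Csin (w : C) : C :=
  ((Cexp (Ci * w) - Cexp (- (Ci * w))) / (RtoC 2 * Ci))%C.

Definition punctured (z : C) : Prop := z <> RtoC 0.

(* Only the values on [punctured] are meaningful: Coquelicot's inverse of 0 is
   a junk value, so every notion below takes the domain into account. *)
Definition sin_inv_pow (p : nat) (z : C) : C := Csin (/ (z ^ (p - 1)))%C.

Definition cusp_region (p : nat) (gamma : R) (z : C) : Prop :=
  Rabs (Im z) <= gamma * Rabs (Re z) ^ p.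

Definition rho (A alpha beta : R) (z : C) : Prop :=
  Rabs (Re z - (alpha + beta) / 2) <= A * ((beta - alpha) / 2) /\
  Rabs (Im z) <= sqrt (A ^ 2 - 1) * ((beta - alpha) / 2).

Definition unit_segment (z : C) : Prop :=
  exists x : R, -1 <= x <= 1 /\ z = RtoC x.

(* The supremum is taken in the extended reals, so it is +oo when |g| is
   unbounded on the part of S lying in the domain. *)
Definition sup_mod (dom : C -> Prop) (g : C -> C) (S : C -> Prop) : Rbar :=
  Lub_Rbar (fun r : R => exists z : C, S z /\ dom z /\ r = Cmod (g z)).

(* Analyticity of g : dom -> C on S: each point of S has a disc, contained in
   the domain, on which g is the sum of a power series centred at that point.
   In particular S must lie in the domain. *)
Definition analytic_on (dom : C -> Prop) (g : C -> C) (S : C -> Prop) : Prop :=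
  forall z0 : C, S z0 ->
    exists (r : R) (a : nat -> C), 0 < r /\
      forall z : C, Cmod (z - z0)%C < r ->
        dom z /\ is_pseries a (z - z0)%C (g z).

(* Main.v *)
Require Import Defs.
From Stdlib Require Import Reals Lra Lia Factorial IndefiniteDescription.
From Coquelicot Require Import Coquelicot.
Open Scope R_scope.

(** On the cusp [|y| <= gamma |x|^p] the number [w = 1/z^(p-1)] stays in a
    horizontal strip.  Indeed [|Im u^n| <= n |Im u| |u|^(n-1)] for every [u]
    ([Im_pow_le]); taking [u = 1/z] and [n = p-1] gives
    [|Im w| <= (p-1) |y| / |z|^p <= (p-1) gamma].  Since
    [|sin w| <= exp |Im w|], the choice [gamma = ln c / (p-1)] bounds [|f|] by
    [c] on the whole region ([Cmod_sin_inv_pow_le]), while the supremum of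
    [|f|] over [[-1,1]] is at least 1, because [sin (PI/2) = 1] is attained at
    [x = (2/PI)^(1/(p-1))].

    If the rectangle [rho] lies in the cusp region, it cannot contain 0: it
    would then contain a point [iy] with [y > 0], whereas the region meets the
    imaginary axis only at 0 ([rho_avoids_0]).  So the bound applies on it, and
    it remains to see that [f] is analytic away from 0
    ([analytic_on_sin_inv_pow]).

    Analyticity is proved without complex derivatives, in the Banach algebra of
    power series [sum a_n h^n] with [sum |a_n| r^n] finite.  Membership with an
    upper bound on this norm is [has_expansion].  A series of members whose
    norms are summable is again a member ([has_expansion_series], an
    interchange of two summations), hence so are products, powers and the
    composition of a member with an entire function ([has_expansion_comp]).
    The geometric series puts [h |-> 1/(z0+h)] in the algebra with
    [r = |z0|/2], and the sine is entire: its power series comes from that of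
    [Cexp], obtained by applying Taylor's formula to real functions
    [t |-> Re (c Cexp(t w))] ([is_series_Cexp]). *)

(** * Interchanging summations *)

Lemma is_series_of_error_bound {K : AbsRing} {V : NormedModule K}
    (a : nat -> V) (l : V) (e : nat -> R) :
  (forall n, norm (minus (sum_n a n) l) <= e n) -> is_lim_seq e 0 ->
  is_series a l.
Proof.
intros Ha He.
apply filterlim_locally_ball_norm; intros eps.
apply is_lim_seq_spec in He.
destruct (He eps) as [N HN]; exists N; intros n Hn.
apply Rle_lt_trans with (1 := Ha n).
specialize (HN n Hn); rewrite Rminus_0_r in HN.
now apply Rle_lt_trans with (1 := Rle_abs _).
Qed.

Lemma norm_series_le {K : AbsRing} {V : NormedModule K}
    (a : nat -> V) (t : nat -> R) (l : V) (T : R) :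
  (forall n, norm (a n) <= t n) -> is_series a l -> is_series t T ->
  norm l <= T.
Proof.
intros Hle Ha Ht.
apply (is_lim_seq_le (fun n => norm (sum_n a n)) (sum_n t) (norm l) T).
- intros n; unfold sum_n.
  apply Rle_trans with (1 := norm_sum_n_m a 0 n).
  now apply sum_n_m_le.
- exact (filterlim_comp _ _ _ _ _ _ _ _ Ha (filterlim_norm l)).
- exact Ht.
Qed.

Lemma sum_n_le_series (t : nat -> R) (T : R) (N : nat) :
  (forall n, 0 <= t n) -> is_series t T -> sum_n t N <= T.
Proof.
intros Hpos Ht.
apply (is_lim_seq_incr_compare (sum_n t) T Ht).
intros n; rewrite sum_Sn; specialize (Hpos (S n)).
unfold plus; simpl; lra.
Qed.

Lemma sum_n_ge_0 (t : nat -> R) (N : nat) :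
  (forall n, 0 <= t n) -> 0 <= sum_n t N.
Proof.
intros Hpos; induction N as [|N IH].
- rewrite sum_O; apply Hpos.
- rewrite sum_Sn; unfold plus; simpl; specialize (Hpos (S N)); lra.
Qed.

Lemma term_le_series (t : nat -> R) (T : R) (n : nat) :
  (forall n, 0 <= t n) -> is_series t T -> t n <= T.
Proof.
intros Hpos Ht.
apply Rle_trans with (2 := sum_n_le_series t T n Hpos Ht).
destruct n as [|n]; [rewrite sum_O; apply Rle_refl|].
rewrite sum_Sn; assert (H := sum_n_ge_0 t n Hpos).
unfold plus; simpl; lra.
Qed.

Lemma is_lim_seq_sum_n_0 (e : nat -> nat -> R) (K : nat) :
  (forall k, is_lim_seq (e k) 0) ->
  is_lim_seq (fun N => sum_n (fun k => e k N) K) 0.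
Proof.
intros He; induction K as [|K IH].
- apply is_lim_seq_ext with (e 0%nat); [|apply He].
  now intros N; rewrite sum_O.
- apply is_lim_seq_ext with
    (fun N => sum_n (fun k => e k N) K + e (S K) N).
  + now intros N; rewrite sum_Sn.
  + replace (Finite 0) with (Finite (0 + 0)) by (f_equal; ring).
    now apply is_lim_seq_plus'.
Qed.

(** Dominated convergence for series: beyond a large index the sums are below
    a tail of [s], and the finitely many terms before it tend to 0 one by
    one. *)
Lemma tannery (e : nat -> nat -> R) (s : nat -> R) :
  (forall k N, 0 <= e k N <= s k) -> ex_series s ->
  (forall k, is_lim_seq (e k) 0) ->
  is_lim_seq (fun N => Series (fun k => e k N)) 0.
Proof.
intros He [S HS] Hlim.
assert (Hex : forall N, ex_series (fun k => e k N)).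
{ intros N; apply (@ex_series_le R_AbsRing R_CompleteNormedModule) with s.
  - intros k; unfold norm; simpl; unfold abs; simpl.
    rewrite Rabs_pos_eq; apply He.
  - now exists S. }
apply is_lim_seq_spec; intros eps.
assert (HS' : is_lim_seq (sum_n s) S) by exact HS.
apply is_lim_seq_spec in HS'.
destruct (HS' (pos_div_2 eps)) as [K HK].
specialize (HK K (Nat.le_refl K)).
apply Rabs_lt_between in HK; simpl in HK.
assert (Hfin := is_lim_seq_sum_n_0 e K Hlim).
apply is_lim_seq_spec in Hfin.
destruct (Hfin (pos_div_2 eps)) as [N0 HN0]; exists N0; intros N HN.
specialize (HN0 N HN); rewrite Rminus_0_r in *.
apply Rabs_lt_between in HN0; simpl in HN0.
assert (HeN := Series_correct _ (Hex N)).
assert (H0 : 0 <= Series (fun k => e k N)).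
{ apply Rle_trans with (sum_n (fun k => e k N) 0).
  - rewrite sum_O; apply He.
  - apply sum_n_le_series with (2 := HeN); intros k; apply He. }
(* The tail of [e . N] beyond [K] is at most that of [s], because the partial
   sums of the nonnegative series [s - e . N] are below its total. *)
assert (Htail : sum_n (fun k => s k - e k N) K
                <= S - Series (fun k => e k N)).
{ apply sum_n_le_series.
  - intros k; specialize (He k N); lra.
  - exact (is_series_minus s (fun k => e k N) S _ HS HeN). }
assert (Hsplit : sum_n s K
   = sum_n (fun k => s k - e k N) K + sum_n (fun k => e k N) K).
{ transitivity (sum_n (fun k => plus (s k - e k N) (e k N)) K).
  - apply sum_n_ext; intros k; unfold plus; simpl; ring.
  - now rewrite sum_n_plus. }
rewrite Rabs_pos_eq by exact H0; lra.
Qed.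

Lemma is_series_sum_n {K : AbsRing} {V : NormedModule K}
    (a : nat -> nat -> V) (c : nat -> V) (N : nat) :
  (forall n, is_series (fun k => a k n) (c n)) ->
  is_series (fun k => sum_n (a k) N) (sum_n c N).
Proof.
intros Hc; induction N as [|N IH].
- rewrite sum_O; apply is_series_ext with (2 := Hc 0%nat).
  now intros k; rewrite sum_O.
- rewrite sum_Sn; apply is_series_ext with (2 := is_series_plus _ _ _ _ IH (Hc (S N))).
  now intros k; rewrite sum_Sn.
Qed.

Lemma norm_series_tail_le {K : AbsRing} {V : NormedModule K}
    (a : nat -> V) (t : nat -> R) (l : V) (T : R) (N : nat) :
  (forall n, norm (a n) <= t n) -> is_series a l -> is_series t T ->
  norm (minus l (sum_n a N)) <= T - sum_n t N.
Proof.
intros Hle Ha Ht.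
apply norm_series_le with (fun n => a (S N + n)%nat) (fun n => t (S N + n)%nat).
- intros n; apply Hle.
- apply is_series_incr_n; [lia|]; simpl pred.
  refine (eq_ind_r (is_series a) Ha _).
  unfold minus; rewrite <- plus_assoc.
  exact (eq_trans (f_equal (plus l) (plus_opp_l _)) (plus_zero_r l)).
- apply (@is_series_incr_n R_AbsRing R_NormedModule t (S N)); [lia|]; simpl pred.
  refine (eq_ind_r (is_series t) Ht _).
  change (T - sum_n t N + sum_n t N = T); ring.
Qed.

(** Fubini's theorem for a double series dominated by [t]: the rows [a k] have
    sums [b k] and the columns have sums [c n].  The total [l] of the row sums
    minus the first [N] columns is the sum over [k] of the row tails; these are
    bounded by the tails of [t k], to which [tannery] applies. *)
Lemma is_series_exchange {K : AbsRing} {V : NormedModule K}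
    (a : nat -> nat -> V) (t : nat -> nat -> R) (s : nat -> R)
    (b c : nat -> V) (l : V) :
  (forall k n, norm (a k n) <= t k n) ->
  (forall k, is_series (t k) (s k)) -> ex_series s ->
  (forall k, is_series (a k) (b k)) ->
  (forall n, is_series (fun k => a k n) (c n)) ->
  is_series b l -> is_series c l.
Proof.
intros Hle Ht Hs Hb Hc Hl.
set (e := fun k N => s k - sum_n (t k) N).
assert (Htpos : forall k n, 0 <= t k n).
{ intros k n; apply Rle_trans with (2 := Hle k n); apply norm_ge_0. }
assert (He : forall k N, 0 <= e k N <= s k).
{ intros k N; unfold e; split.
  - assert (H := sum_n_le_series (t k) (s k) N (Htpos k) (Ht k)); lra.
  - assert (H := sum_n_ge_0 (t k) N (Htpos k)); lra. }
apply is_series_of_error_bound with (fun N => Series (fun k => e k N)).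
- intros N.
  assert (Hd := is_series_minus _ _ _ _ Hl (is_series_sum_n a c N Hc)).
  assert (Hsym := f_equal norm (opp_minus (sum_n c N) l)).
  rewrite norm_opp in Hsym; rewrite Hsym.
  refine (norm_series_le _ (fun k => e k N) _ _ _ Hd (Series_correct _ _)).
  + intros k; exact (norm_series_tail_le _ _ _ _ N (Hle k) (Hb k) (Ht k)).
  + apply (@ex_series_le R_AbsRing R_CompleteNormedModule) with s; [|exact Hs].
    intros k; unfold norm; simpl; unfold abs; simpl.
    rewrite Rabs_pos_eq; apply He.
- apply tannery with (s := s); [exact He|exact Hs|].
  intros k; unfold e.
  replace (Finite 0) with (Finite (s k - s k)) by (f_equal; ring).
  apply is_lim_seq_minus'; [apply is_lim_seq_const|exact (Ht k)].
Qed.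

(** * Power series with absolutely summable coefficients *)

(** [ring] recognises its carrier syntactically, so the abstract operations
    that the series lemmas leave behind, and the type of the equation, have to
    be reduced to those of the concrete field first. *)
Ltac ring_in T :=
  unfold scal; simpl; unfold mult, plus, opp; simpl;
  match goal with |- @eq _ ?x ?y => change (@eq T x y) end; ring.

(** The function [g] agrees, on the closed disc of radius [r], with an element
    of norm at most [M] of the Wiener algebra of power series.  The bound is
    part of the predicate since infinite sums of such functions are controlled
    through their norms. *)
Definition has_expansion (r M : R) (g : C -> C) : Prop :=
  exists (a : nat -> C) (m : R),
    is_series (fun n => Cmod (a n) * r ^ n) m /\ m <= M /\
    forall h : C, Cmod h <= r -> is_series (fun n => (a n * h ^ n)%C) (g h).

Lemma has_expansion_ext (r M : R) (g1 g2 : C -> C) :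
  (forall h, Cmod h <= r -> g1 h = g2 h) ->
  has_expansion r M g1 -> has_expansion r M g2.
Proof.
intros Hg (a & m & Ha & Hm & Hs); exists a, m; repeat split; auto.
intros h Hh; rewrite <- Hg by exact Hh; now apply Hs.
Qed.

Lemma has_expansion_scal (r M : R) (c : C) (g : C -> C) :
  has_expansion r M g -> has_expansion r (Cmod c * M) (fun h => (c * g h)%C).
Proof.
intros (a & m & Ha & Hm & Hs); exists (fun n => (c * a n)%C), (Cmod c * m).
repeat split.
- apply is_series_ext with (2 := is_series_scal_l (Cmod c) _ _ Ha).
  intros n; rewrite Cmod_mult; ring_in R.
- apply Rmult_le_compat_l; [apply Cmod_ge_0|exact Hm].
- intros h Hh.
  apply is_series_ext with (2 := is_series_scal_l c _ _ (Hs h Hh)).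
  intros n; ring_in C.
Qed.

Lemma has_expansion_mul_id (r M : R) (g : C -> C) :
  0 <= r -> has_expansion r M g -> has_expansion r (r * M) (fun h => (h * g h)%C).
Proof.
intros Hr (a & m & Ha & Hm & Hs).
exists (fun n => match n with O => RtoC 0 | S n => a n end), (r * m).
repeat split.
- apply (@is_series_decr_1 R_AbsRing R_NormedModule).
  refine (eq_ind_r (is_series _)
    (is_series_ext _ _ _ _ (is_series_scal_l r _ _ Ha)) _).
  + intros n; ring_in R.
  + rewrite Cmod_0; ring_in R.
- now apply Rmult_le_compat_l.
- intros h Hh.
  apply (@is_series_decr_1 C_AbsRing C_NormedModule).
  refine (eq_ind_r (is_series _)
    (is_series_ext _ _ _ _ (is_series_scal_l h _ _ (Hs h Hh))) _).
  + intros n; ring_in C.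
  + ring_in C.
Qed.

(** Completeness of the algebra.  Coefficients are summed index by index; both
    the bound on the norm and the value of the sum follow from
    [is_series_exchange], applied to the norms and to the terms themselves. *)
Lemma has_expansion_series (r T : R) (M : nat -> R) (g : nat -> C -> C)
    (G : C -> C) :
  0 < r -> (forall k, has_expansion r (M k) (g k)) -> is_series M T ->
  (forall h, Cmod h <= r -> is_series (fun k => g k h) (G h)) ->
  has_expansion r T G.
Proof.
intros Hr Hg HS HG.
apply functional_choice in Hg; destruct Hg as [a Hg].
apply functional_choice in Hg; destruct Hg as [m Hg].
set (t := fun k n => Cmod (a k n) * r ^ n).
assert (Ht : forall k, is_series (t k) (m k)) by (intros k; apply Hg).
assert (Hm : forall k, m k <= M k) by (intros k; apply Hg).
assert (Htpos : forall k n, 0 <= t k n).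
{ intros k n; apply Rmult_le_pos; [apply Cmod_ge_0|apply pow_le; lra]. }
assert (Htm : forall k n, t k n <= m k).
{ intros k n; now apply term_le_series. }
assert (Hm0 : forall k, 0 <= m k).
{ intros k; apply Rle_trans with (2 := Htm k O); apply Htpos. }
assert (HmS : ex_series m).
{ apply (@ex_series_le R_AbsRing R_CompleteNormedModule) with M.
  - intros k; unfold norm; simpl; unfold abs; simpl.
    now rewrite Rabs_pos_eq.
  - now exists T. }
assert (Hcol : forall n, is_series (fun k => t k n) (Series (fun k => t k n))).
{ intros n; apply Series_correct.
  apply (@ex_series_le R_AbsRing R_CompleteNormedModule) with m; [|exact HmS].
  intros k; unfold norm; simpl; unfold abs; simpl.
  now rewrite Rabs_pos_eq. }
(* The [k]-th series bounds each of its coefficients by [|a k n| <= m k / r^n],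
   so the columns converge absolutely; this is where [r > 0] is used. *)
assert (Hc : exists c : nat -> C, forall n, is_series (fun k => a k n) (c n)).
{ apply (functional_choice (fun n c => is_series (fun k => a k n) c)); intros n.
  apply (@ex_series_le C_AbsRing C_CompleteNormedModule)
    with (fun k => t k n * / r ^ n).
  - intros k; unfold t; rewrite Rmult_assoc, Rinv_r, Rmult_1_r.
    + apply Rle_refl.
    + apply pow_nonzero; lra.
  - exists (Series (fun k => t k n) * / r ^ n).
    now apply is_series_scal_r. }
destruct Hc as [c Hc].
assert (Hsum : is_series (fun n => Series (fun k => t k n)) (Series m)).
{ apply (is_series_exchange t t m m) with (4 := Ht); auto.
  - intros k n; unfold norm; simpl; unfold abs; simpl.
    rewrite Rabs_pos_eq; auto using Rle_refl.
  - now apply Series_correct. }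
assert (Hcle : forall n, Cmod (c n) * r ^ n <= Series (fun k => t k n)).
{ intros n.
  apply Rmult_le_reg_r with (/ r ^ n).
  { apply Rinv_0_lt_compat, pow_lt, Hr. }
  rewrite Rmult_assoc, Rinv_r, Rmult_1_r by (apply pow_nonzero; lra).
  change (@norm C_AbsRing C_NormedModule (c n) <= Series (fun k => t k n) * / r ^ n).
  apply (norm_series_le (fun k => a k n : C_NormedModule) (fun k => t k n * / r ^ n)).
  - intros k; unfold t; rewrite Rmult_assoc, Rinv_r, Rmult_1_r.
    + apply Rle_refl.
    + apply pow_nonzero; lra.
  - apply Hc.
  - now apply is_series_scal_r. }
assert (Hcpos : forall n, 0 <= Cmod (c n) * r ^ n).
{ intros n; apply Rmult_le_pos; [apply Cmod_ge_0|apply pow_le; lra]. }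
exists c, (Series (fun n => Cmod (c n) * r ^ n)); repeat split.
- apply Series_correct.
  apply (@ex_series_le R_AbsRing R_CompleteNormedModule)
    with (fun n => Series (fun k => t k n)).
  + intros n; unfold norm; simpl; unfold abs; simpl.
    now rewrite Rabs_pos_eq.
  + now exists (Series m).
- apply Rle_trans with (Series m).
  + rewrite <- (is_series_unique _ _ Hsum).
    apply Series_le; [now split|now exists (Series m)].
  + rewrite <- (is_series_unique _ _ HS).
    apply Series_le; [now split|now exists T].
- intros h Hh.
  apply (is_series_exchange (V := C_NormedModule)
    (fun k n => (a k n * h ^ n)%C) t m (fun k => g k h)); auto.
  + intros k n; change (Cmod (a k n * h ^ n)%C <= t k n).
    unfold t; rewrite Cmod_mult, Cmod_pow.
    apply Rmult_le_compat_l; [apply Cmod_ge_0|].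
    apply pow_incr; split; [apply Cmod_ge_0|exact Hh].
  + intros k; now apply Hg.
  + intros n.
    rewrite (Cmult_comm (c n)).
    apply is_series_ext with (2 := is_series_scal_l (h ^ n)%C _ _ (Hc n)).
    intros k; ring_in C.
Qed.

Lemma has_expansion_le (r M M' : R) (g : C -> C) :
  M <= M' -> has_expansion r M g -> has_expansion r M' g.
Proof.
intros HM (a & m & Ha & Hm & Hs); exists a, m; repeat split; auto; lra.
Qed.

(** The product is the series of the functions [a_k h^k g2(h)], whose norms are
    at most [|a_k| r^k M2]. *)
Lemma has_expansion_mult (r M1 M2 : R) (g1 g2 : C -> C) :
  0 < r -> has_expansion r M1 g1 -> has_expansion r M2 g2 ->
  has_expansion r (M1 * M2) (fun h => (g1 h * g2 h)%C).
Proof.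
intros Hr (a & m & Ha & Hm & Hs) H2.
assert (HM2 : 0 <= M2).
{ destruct H2 as (b & m2 & Hb & Hm2 & _).
  apply Rle_trans with (2 := Hm2).
  assert (Hpos : forall n, 0 <= Cmod (b n) * r ^ n).
  { intros n; apply Rmult_le_pos; [apply Cmod_ge_0|apply pow_le; lra]. }
  exact (Rle_trans _ _ _ (Hpos O) (term_le_series _ _ O Hpos Hb)). }
apply has_expansion_le with (m * M2); [now apply Rmult_le_compat_r|].
apply has_expansion_series with
  (M := fun k => Cmod (a k) * r ^ k * M2)
  (g := fun k h => (a k * h ^ k * g2 h)%C); [exact Hr| | |].
- intros k.
  assert (Hk : has_expansion r (r ^ k * M2) (fun h => (h ^ k * g2 h)%C)).
  { induction k as [|k IH].
    - apply has_expansion_ext with g2; [intros h _; simpl; ring|].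
      now rewrite pow_O, Rmult_1_l.
    - simpl; rewrite Rmult_assoc.
      apply has_expansion_ext with (2 := has_expansion_mul_id _ _ _ (Rlt_le _ _ Hr) IH).
      intros h _; simpl; ring. }
  rewrite Rmult_assoc.
  apply has_expansion_ext with (2 := has_expansion_scal _ _ (a k) _ Hk).
  intros h _; simpl; ring.
- now apply is_series_scal_r.
- intros h Hh.
  rewrite Cmult_comm.
  apply is_series_ext with (2 := is_series_scal_l (g2 h) _ _ (Hs h Hh)).
  intros n; ring_in C.
Qed.

Lemma is_series_head {K : AbsRing} {V : NormedModule K} (a : nat -> V) :
  (forall n, a (S n) = zero) -> is_series a (a 0%nat).
Proof.
intros Ha; apply is_series_of_error_bound with (fun _ => 0).
- intros n.
  assert (E : sum_n a n = a 0%nat).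
  { induction n as [|n IH]; [now rewrite sum_O|].
    rewrite sum_Sn, IH, Ha; apply plus_zero_r. }
  rewrite E; unfold minus.
  right; exact (eq_trans (f_equal norm (plus_opp_r (a 0%nat))) norm_zero).
- apply is_lim_seq_const.
Qed.

Lemma has_expansion_one (r : R) : 0 <= r -> has_expansion r 1 (fun _ => RtoC 1).
Proof.
intros Hr; exists (fun n => match n with O => RtoC 1 | S _ => RtoC 0 end), 1.
repeat split.
- refine (eq_ind _ (is_series _) (is_series_head _ _) _ _).
  + intros n; rewrite Cmod_0; apply Rmult_0_l.
  + rewrite Cmod_1; apply Rmult_1_l.
- lra.
- intros h _.
  refine (eq_ind _ (is_series _) (is_series_head (V := C_NormedModule) _ _) _ _).
  + intros n; apply Cmult_0_l.
  + apply Cmult_1_l.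
Qed.

Lemma has_expansion_pow (r M : R) (g : C -> C) (n : nat) :
  0 < r -> has_expansion r M g -> has_expansion r (M ^ n) (fun h => (g h ^ n)%C).
Proof.
intros Hr Hg; induction n as [|n IH]; simpl.
- now apply has_expansion_one, Rlt_le.
- now apply has_expansion_mult.
Qed.

(** The composition is the series of the functions [s_n g^n], of norm at most
    [|s_n| M^n]. *)
Lemma has_expansion_comp (r M : R) (g : C -> C) (s : nat -> C) (F : C -> C) :
  0 < r -> has_expansion r M g ->
  ex_series (fun n => Cmod (s n) * M ^ n) ->
  (forall w : C, is_series (fun n => (s n * w ^ n)%C) (F w)) ->
  exists M', has_expansion r M' (fun h => F (g h)).
Proof.
intros Hr Hg [M' HM'] HF; exists M'.
apply has_expansion_series with (M := fun n => Cmod (s n) * M ^ n)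
  (g := fun n h => (s n * g h ^ n)%C); auto.
intros n; now apply has_expansion_scal, has_expansion_pow.
Qed.

(** * Reciprocal, exponential and sine as power series *)

Lemma is_series_geom_C (q : C) :
  Cmod q < 1 -> is_series (fun n => (q ^ n)%C) (/ (1 - q))%C.
Proof.
intros Hq.
assert (Hq1 : (1 - q <> 0)%C).
{ intros H; apply (Rlt_irrefl 1).
  assert (E : q = RtoC 1).
  { transitivity (1 - (1 - q))%C; [ring|rewrite H; ring]. }
  now rewrite E, Cmod_1 in Hq. }
apply (is_series_of_error_bound (V := C_NormedModule))
  with (fun n => Cmod q * / Cmod (1 - q)%C * Cmod q ^ n).
- intros n; change (Cmod (sum_n (fun n => q ^ n)%C n - / (1 - q))%C
    <= Cmod q * / Cmod (1 - q)%C * Cmod q ^ n).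
  assert (E : sum_n (fun n => q ^ n)%C n = ((1 - q ^ S n) / (1 - q))%C).
  { induction n as [|n IH].
    - rewrite sum_O; simpl; field; exact Hq1.
    - rewrite sum_Sn, IH; change plus with Cplus; simpl; field; exact Hq1. }
  rewrite E.
  replace ((1 - q ^ S n) / (1 - q) - / (1 - q))%C with (- (q ^ S n / (1 - q)))%C
    by (simpl; field; exact Hq1).
  rewrite Cmod_opp, Cmod_div, Cmod_pow by exact Hq1.
  right; simpl; unfold Rdiv; ring.
- replace (Finite 0) with (Finite (Cmod q * / Cmod (1 - q)%C * 0)) by (f_equal; ring).
  apply (is_lim_seq_scal_l (fun n => Cmod q ^ n) (Cmod q * / Cmod (1 - q)%C) 0).
  apply is_lim_seq_geom; rewrite Rabs_pos_eq; [exact Hq|apply Cmod_ge_0].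
Qed.

(** [1/(z0+h) = (1/z0) / (1 - q)] with [q = -h/z0].  On the disc of radius
    [|z0|/2] the ratio [q] has modulus at most 1/2, whence the norm
    [2/|z0|]. *)
Lemma has_expansion_inv (z0 : C) :
  z0 <> RtoC 0 ->
  has_expansion (Cmod z0 / 2) (2 * / Cmod z0) (fun h => (/ (z0 + h))%C).
Proof.
intros Hz0.
assert (Hpos : 0 < Cmod z0) by now apply Cmod_gt_0.
exists (fun n => (/ z0 * (- / z0) ^ n)%C), (2 * / Cmod z0); repeat split.
- replace (2 * / Cmod z0) with (/ (1 - / 2) * / Cmod z0) by (field; lra).
  apply is_series_ext with (fun n => (/ 2) ^ n * / Cmod z0).
  + intros n.
    rewrite Cmod_mult, Cmod_pow, Cmod_opp, Cmod_inv by exact Hz0.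
    rewrite Rmult_assoc, <- Rpow_mult_distr.
    replace (/ Cmod z0 * (Cmod z0 / 2)) with (/ 2) by (field; lra).
    apply Rmult_comm.
  + apply is_series_scal_r, is_series_geom.
    rewrite Rabs_pos_eq; lra.
- lra.
- intros h Hh.
  assert (Hq : Cmod (- / z0 * h)%C < 1).
  { rewrite Cmod_mult, Cmod_opp, Cmod_inv by exact Hz0.
    apply Rmult_lt_reg_l with (Cmod z0); [exact Hpos|].
    rewrite <- Rmult_assoc, Rinv_r by lra; lra. }
  assert (Hz : (z0 + h)%C <> RtoC 0).
  { intros E; apply (Rlt_irrefl (Cmod z0)).
    assert (Ez : z0 = (- h)%C).
    { transitivity (z0 + h - h)%C; [ring|rewrite E; ring]. }
    rewrite Ez at 1; rewrite Cmod_opp; lra. }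
  replace (/ (z0 + h))%C with (/ z0 * / (1 - - / z0 * h))%C.
  + apply is_series_ext with (2 := is_series_scal_l (/ z0)%C _ _ (is_series_geom_C _ Hq)).
    intros n; change (/ z0 * (- / z0 * h) ^ n = / z0 * (- / z0) ^ n * h ^ n)%C.
    rewrite Cpow_mult_l; ring.
  + field; auto.
Qed.

Lemma exp_le_compat (x y : R) : x <= y -> exp x <= exp y.
Proof. intros [H| ->]; [left; now apply exp_increasing|apply Rle_refl]. Qed.

Lemma Cmod_Cexp (w : C) : Cmod (Cexp w) = exp (Re w).
Proof.
unfold Cexp; rewrite Cmod_mult, Cmod_R, (Rabs_pos_eq (exp _)) by (left; apply exp_pos).
replace (Cmod _) with 1; [ring|].
unfold Cmod; simpl.
match goal with |- _ = sqrt ?x => replace x with 1 end; [now rewrite sqrt_1|].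
assert (H := sin2_cos2 (Im w)); unfold Rsqr in H; lra.
Qed.

(** The factor [c] makes the family of functions [t |-> Re (c Cexp(t w))] stable
    under differentiation, [c] becoming [c w]. *)
Lemma is_derive_Re_Cexp (c w : C) (t : R) :
  is_derive (fun t => Re (c * Cexp (RtoC t * w))) t
    (Re (c * w * Cexp (RtoC t * w))).
Proof.
destruct c as [a b], w as [x y]; unfold Cexp; simpl.
auto_derive; [exact I|].
unfold Rminus; ring.
Qed.

Lemma Derive_n_Re_Cexp (c w : C) (n : nat) (t : R) :
  Derive_n (fun t => Re (c * Cexp (RtoC t * w))) n t
    = Re (c * w ^ n * Cexp (RtoC t * w)) /\
  ex_derive_n (fun t => Re (c * Cexp (RtoC t * w))) n t.
Proof.
revert t; induction n as [|n IH]; intros t.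
- split; [simpl Cpow; rewrite Cmult_1_r; reflexivity|exact I].
- assert (H : is_derive (Derive_n (fun t => Re (c * Cexp (RtoC t * w))) n) t
            (Re (c * w ^ S n * Cexp (RtoC t * w)))).
  { apply is_derive_ext with (fun t => Re (c * w ^ n * Cexp (RtoC t * w))).
    - intros s; symmetry; apply IH.
    - replace (c * w ^ S n)%C with (c * w ^ n * w)%C by (simpl; ring).
      apply is_derive_Re_Cexp. }
  split; [now apply is_derive_unique|now exists (Re (c * w ^ S n * Cexp (RtoC t * w)))].
Qed.

Definition exp_coeff (n : nat) : C := RtoC (/ INR (fact n)).

(** Taylor-Lagrange formula on [[0,1]]; the factor [c] gives access to the
    imaginary part as well, with [c = -i]. *)
Lemma Re_Cexp_taylor (c w : C) (n : nat) :
  Rabs (Re (c * (sum_n (fun k => exp_coeff k * w ^ k)%C n - Cexp w)))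
    <= Cmod c * exp (Cmod w) * (Cmod w ^ S n / INR (fact (S n))).
Proof.
destruct (Taylor_Lagrange (fun t => Re (c * Cexp (RtoC t * w))) n 0 1)
  as (zeta & Hzeta & E); [lra| |].
{ intros t _ k _; apply Derive_n_Re_Cexp. }
rewrite Cmult_1_l in E.
assert (Hsum : Re (c * sum_n (fun k => exp_coeff k * w ^ k)%C n)
  = sum_f_R0 (fun m => (1 - 0) ^ m / INR (fact m) *
      Derive_n (fun t => Re (c * Cexp (RtoC t * w))) m 0) n).
{ clear E Hzeta.
  assert (Hk : forall k, Re (c * (exp_coeff k * w ^ k)) = (1 - 0) ^ k / INR (fact k) *
      Derive_n (fun t => Re (c * Cexp (RtoC t * w))) k 0).
  { intros k; rewrite (proj1 (Derive_n_Re_Cexp c w k 0)), Rminus_0_r, pow1.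
    replace (Cexp (0 * w)) with (RtoC 1).
    - rewrite Cmult_1_r; unfold exp_coeff.
      replace (c * (RtoC (/ INR (fact k)) * w ^ k))%C
        with (RtoC (/ INR (fact k)) * (c * w ^ k))%C by ring.
      rewrite re_scal_l; unfold Rdiv; ring.
    - rewrite Cmult_0_l; unfold Cexp; simpl; rewrite exp_0, cos_0, sin_0; ring. }
  induction n as [|n IH].
  - rewrite sum_O; apply Hk.
  - rewrite sum_Sn, tech5, <- IH, <- Hk, <- re_plus.
    f_equal; change plus with Cplus; ring. }
replace (Re (c * (sum_n (fun k => exp_coeff k * w ^ k)%C n - Cexp w)))
  with (Re (c * sum_n (fun k => exp_coeff k * w ^ k)%C n) - Re (c * Cexp w)).
2: { unfold Rminus; rewrite <- re_opp, <- re_plus; f_equal; ring. }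
rewrite Hsum, E.
rewrite (proj1 (Derive_n_Re_Cexp c w (S n) zeta)), Rminus_0_r, pow1.
match goal with |- Rabs (?s - (?s + ?x)) <= _ => replace (s - (s + x)) with (- x) by ring end.
assert (Hf : 0 < / INR (fact (S n))) by apply Rinv_0_lt_compat, INR_fact_lt_0.
rewrite Rabs_Ropp, Rabs_mult; unfold Rdiv; rewrite Rmult_1_l, (Rabs_pos_eq (/ _)) by lra.
assert (Hre : Rabs (Re (c * w ^ S n * Cexp (zeta * w)))
              <= Cmod c * Cmod w ^ S n * exp (Cmod w)).
{ apply Rle_trans with (1 := re_le_Cmod _).
  rewrite 2!Cmod_mult, Cmod_pow, Cmod_Cexp.
  apply Rmult_le_compat_l.
  - apply Rmult_le_pos; [apply Cmod_ge_0|apply pow_le, Cmod_ge_0].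
  (* [Re (zeta w) <= |w|] because [0 < zeta < 1]. *)
  - apply exp_le_compat; rewrite re_scal_l.
    assert (H1 := re_le_Cmod w); assert (H2 := Rle_abs (Re w)).
    assert (H3 := Cmod_ge_0 w).
    nra. }
apply Rmult_le_compat_l with (r := / INR (fact (S n))) in Hre; [|lra].
apply Rle_trans with (1 := Hre); right; ring.
Qed.

Lemma is_series_Cexp (w : C) :
  is_series (fun n => (exp_coeff n * w ^ n)%C) (Cexp w).
Proof.
apply (is_series_of_error_bound (V := C_NormedModule))
  with (fun n => 2 * exp (Cmod w) * (Cmod w ^ S n / INR (fact (S n)))).
(* The modulus is at most the sum of the moduli of the real and imaginary
   parts; hence the factor 2. *)
- intros n; set (d := minus _ _).
  assert (H1 := Re_Cexp_taylor 1 w n).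
  assert (H2 := Re_Cexp_taylor (- Ci) w n).
  rewrite Cmult_1_l, Cmod_1 in H1; rewrite Cmod_opp, Cmod_Ci in H2.
  change (Cmod d <= 2 * exp (Cmod w) * (Cmod w ^ S n / INR (fact (S n)))).
  change (Rabs (Re d) <= 1 * exp (Cmod w) * (Cmod w ^ S n / INR (fact (S n)))) in H1.
  change (Rabs (Re (- Ci * d)) <= 1 * exp (Cmod w) * (Cmod w ^ S n / INR (fact (S n)))) in H2.
  replace (Re (- Ci * d)) with (Im d) in H2 by (destruct d; simpl; ring).
  assert (Hd : Cmod d <= Rabs (Re d) + Rabs (Im d)); [|lra].
  replace d with (RtoC (Re d) + Ci * RtoC (Im d))%C at 1
    by (destruct d; unfold Ci, RtoC, Cplus, Cmult; simpl; f_equal; ring).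
  apply Rle_trans with (1 := Cmod_triangle _ _).
  rewrite Cmod_mult, Cmod_Ci, 2!Cmod_R; lra.
- replace (Finite 0) with (Finite (2 * exp (Cmod w) * 0)) by (f_equal; ring).
  apply (is_lim_seq_scal_l (fun n => Cmod w ^ S n / INR (fact (S n))) (2 * exp (Cmod w)) 0).
  apply (is_lim_seq_incr_1 (fun n => Cmod w ^ n / INR (fact n))).
  apply ex_series_lim_0; exists (exp (Cmod w)).
  apply is_series_ext with (2 := is_exp_Reals (Cmod w)).
  intros n; rewrite pow_n_pow; reflexivity.
Qed.

Lemma two_Ci_neq_0 : (RtoC 2 * Ci)%C <> RtoC 0.
Proof.
intros H; apply (f_equal Cmod) in H.
rewrite Cmod_mult, Cmod_Ci, Cmod_R, Cmod_0, Rabs_pos_eq in H; lra.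
Qed.

Definition sin_coeff (n : nat) : C :=
  (exp_coeff n * ((Ci ^ n - (- Ci) ^ n) / (RtoC 2 * Ci)))%C.

Lemma is_series_Csin (w : C) :
  is_series (fun n => (sin_coeff n * w ^ n)%C) (Csin w).
Proof.
unfold Csin, Cdiv; rewrite (Cmult_comm (_ - _)).
apply is_series_ext with (2 := is_series_scal_l (/ (RtoC 2 * Ci))%C _ _
  (is_series_minus _ _ _ _ (is_series_Cexp (Ci * w)) (is_series_Cexp (- (Ci * w))))).
intros n.
replace (- (Ci * w))%C with (- Ci * w)%C by ring.
rewrite 2!Cpow_mult_l; unfold sin_coeff, Cdiv; ring_in C.
Qed.

Lemma Cmod_sin_coeff_le (n : nat) : Cmod (sin_coeff n) <= / INR (fact n).
Proof.
assert (Hi := two_Ci_neq_0).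
assert (Hf : 0 < / INR (fact n)) by apply Rinv_0_lt_compat, INR_fact_lt_0.
unfold sin_coeff, exp_coeff; rewrite Cmod_mult, Cmod_R, Cmod_div by exact Hi.
rewrite Rabs_pos_eq by lra.
assert (Hd : Cmod (Ci ^ n - (- Ci) ^ n) <= 2).
{ apply Rle_trans with (1 := Cmod_triangle _ _).
  rewrite Cmod_opp, 2!Cmod_pow, Cmod_opp, Cmod_Ci, pow1; lra. }
rewrite Cmod_mult, Cmod_Ci, Cmod_R, (Rabs_pos_eq 2) by lra.
rewrite <- (Rmult_1_r (/ INR (fact n))) at 2.
apply Rmult_le_compat_l; lra.
Qed.

(** * Analyticity away from the origin *)

(** [sin(1/z^(p-1))] is the composition of the entire sine with the [p-1]-st
    power of [h |-> 1/(z0+h)], all in the Wiener algebra of radius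
    [|z0|/2]. *)
Lemma analytic_on_sin_inv_pow (p : nat) (S : C -> Prop) :
  (forall z, S z -> z <> RtoC 0) -> analytic_on punctured (sin_inv_pow p) S.
Proof.
intros HS z0 Hz0; specialize (HS z0 Hz0).
assert (Hpos : 0 < Cmod z0) by now apply Cmod_gt_0.
assert (Hr : 0 < Cmod z0 / 2) by lra.
assert (Hw := has_expansion_pow _ _ _ (p - 1) Hr (has_expansion_inv z0 HS)).
destruct (has_expansion_comp _ _ _ sin_coeff Csin Hr Hw) as (M' & a & m & _ & _ & Ha).
- apply (@ex_series_le R_AbsRing R_CompleteNormedModule)
    with (fun n => / INR (fact n) * ((2 * / Cmod z0) ^ (p - 1)) ^ n).
  + intros n; unfold norm; simpl; unfold abs; simpl.
    assert (Hpow : 0 <= ((2 * / Cmod z0) ^ (p - 1)) ^ n).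
    { apply pow_le, pow_le; left; apply Rmult_lt_0_compat; [lra|].
      now apply Rinv_0_lt_compat. }
    rewrite Rabs_pos_eq.
    * apply Rmult_le_compat_r; [exact Hpow|apply Cmod_sin_coeff_le].
    * apply Rmult_le_pos; [apply Cmod_ge_0|exact Hpow].
  + exists (exp ((2 * / Cmod z0) ^ (p - 1))).
    now apply is_pseries_R, is_exp_Reals.
- exact is_series_Csin.
- exists (Cmod z0 / 2), a; split; [exact Hr|]; intros z Hz.
  assert (Hz' : z <> RtoC 0).
  { intros E; rewrite E in Hz.
    replace (0 - z0)%C with (- z0)%C in Hz by ring.
    rewrite Cmod_opp in Hz; lra. }
  split; [exact Hz'|].
  unfold sin_inv_pow; rewrite <- Cpow_inv by exact Hz'.
  replace z with (z0 + (z - z0))%C at 2 by ring.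
  unfold is_pseries.
  apply is_series_ext with (2 := Ha _ (Rlt_le _ _ Hz)).
  intros n.
  assert (E : @pow_n (AbsRing.Ring C_AbsRing) (z - z0)%C n = ((z - z0) ^ n)%C).
  { induction n as [|n IH]; [reflexivity|simpl; now rewrite IH]. }
  rewrite E; ring_in C.
Qed.

(** * Bound on the cusp region *)

(** Algebraic form of [|sin (n t)| <= n |sin t|], by induction from
    [Im (z z^n) = Re z Im z^n + Im z Re z^n]. *)
Lemma Im_pow_le (z : C) (n : nat) :
  Rabs (Im (z ^ S n)) <= INR (S n) * Rabs (Im z) * Cmod z ^ n.
Proof.
induction n as [|n IH].
- rewrite Cpow_1_r; simpl; lra.
- rewrite Cpow_S, im_mult.
  apply Rle_trans with (1 := Rabs_triang _ _).
  rewrite 2!Rabs_mult.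
  assert (H1 : Rabs (Re (z ^ S n)) <= Cmod z ^ S n).
  { rewrite <- Cmod_pow; apply re_le_Cmod. }
  assert (H2 := re_le_Cmod z).
  assert (H3 : Rabs (Re z) * Rabs (Im (z ^ S n))
               <= Cmod z * (INR (S n) * Rabs (Im z) * Cmod z ^ n)).
  { apply Rmult_le_compat; auto using Rabs_pos. }
  assert (H4 : Rabs (Im z) * Rabs (Re (z ^ S n)) <= Rabs (Im z) * Cmod z ^ S n).
  { apply Rmult_le_compat_l; auto using Rabs_pos. }
  apply Rle_trans with (1 := Rplus_le_compat _ _ _ _ H3 H4).
  rewrite (S_INR (S n)); right; simpl pow; ring.
Qed.

(** [|Cexp v| = exp (Re v)], and the real parts of [iw] and [-iw] are
    [-Im w] and [Im w]. *)
Lemma Cmod_Csin_le (w : C) : Cmod (Csin w) <= exp (Rabs (Im w)).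
Proof.
assert (Hi := two_Ci_neq_0).
assert (Hexp : forall v : C, Re v <= Rabs (Im w) -> Cmod (Cexp v) <= exp (Rabs (Im w))).
{ intros v Hv; rewrite Cmod_Cexp; now apply exp_le_compat. }
unfold Csin; rewrite Cmod_div by exact Hi.
rewrite Cmod_mult, Cmod_Ci, Cmod_R, (Rabs_pos_eq 2) by lra.
assert (H := Cmod_triangle (Cexp (Ci * w)) (- Cexp (- (Ci * w)))).
rewrite Cmod_opp in H; fold (Cminus (Cexp (Ci * w)) (Cexp (- (Ci * w)))) in H.
assert (H1 : Cmod (Cexp (Ci * w)) <= exp (Rabs (Im w))).
{ apply Hexp; replace (Re (Ci * w)) with (- Im w) by (destruct w; simpl; ring).
  rewrite <- Rabs_Ropp; apply Rle_abs. }
assert (H2 : Cmod (Cexp (- (Ci * w))) <= exp (Rabs (Im w))).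
{ apply Hexp; replace (Re (- (Ci * w))) with (Im w) by (destruct w; simpl; ring).
  apply Rle_abs. }
lra.
Qed.

(** The exponent [p] of the cusp exactly balances the growth of
    [Im (1/z^(p-1))], which is of order [|Im z| / |z|^p]; thus the bound does
    not degenerate as [z] tends to 0. *)
Lemma Cmod_sin_inv_pow_le (p : nat) (gamma : R) (z : C) :
  (1 < p)%nat -> 0 <= gamma -> z <> RtoC 0 -> cusp_region p gamma z ->
  Cmod (sin_inv_pow p z) <= exp (INR (p - 1) * gamma).
Proof.
intros Hp Hg Hz Hc; unfold sin_inv_pow.
assert (Hpos : 0 < Cmod z) by now apply Cmod_gt_0.
apply Rle_trans with (1 := Cmod_Csin_le _).
apply exp_le_compat.
rewrite <- Cpow_inv by exact Hz.
destruct p as [|[|n]]; [lia|lia|].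
replace (S (S n) - 1)%nat with (S n) by lia.
apply Rle_trans with (1 := Im_pow_le (/ z) n).
rewrite Rmult_assoc; apply Rmult_le_compat_l; [apply pos_INR|].
assert (Him : Rabs (Im (/ z)) = Rabs (Im z) / Cmod z ^ 2).
{ rewrite Cmod2_alt.
  change (Rabs (- Im z / (Re z ^ 2 + Im z ^ 2)) = Rabs (Im z) / (Re z ^ 2 + Im z ^ 2)).
  unfold Rdiv; rewrite Rabs_mult, Rabs_Ropp; f_equal.
  rewrite <- Cmod2_alt; apply Rabs_pos_eq; left.
  now apply Rinv_0_lt_compat, pow_lt. }
assert (Hy : Rabs (Im z) <= gamma * Cmod z ^ S (S n)).
{ apply Rle_trans with (1 := Hc); apply Rmult_le_compat_l; [exact Hg|].
  apply pow_incr; split; [apply Rabs_pos|apply re_le_Cmod]. }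
rewrite Him, Cmod_inv, pow_inv by exact Hz.
apply Rmult_le_reg_r with (Cmod z ^ S (S n)); [now apply pow_lt|].
apply Rle_trans with (2 := Hy); right.
simpl; field; split; [apply pow_nonzero|]; lra.
Qed.

(** * Suprema and the rectangle *)

Lemma sup_mod_le (dom : C -> Prop) (g : C -> C) (S : C -> Prop) (M : R) :
  (forall z, S z -> dom z -> Cmod (g z) <= M) -> Rbar_le (sup_mod dom g S) M.
Proof.
intros H; apply (proj2 (Lub_Rbar_correct _)).
intros x (z & Hz & Hd & ->); now apply H.
Qed.

(** The point [x = (2/PI)^(1/(p-1))] satisfies [0 < x <= 1] since [2 < PI], and
    [1/x^(p-1) = PI/2]. *)
Lemma sup_unit_segment_ge_1 (p : nat) :
  (1 < p)%nat -> Rbar_le 1 (sup_mod punctured (sin_inv_pow p) unit_segment).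
Proof.
intros Hp.
set (x := Rpower (2 / PI) (/ INR (p - 1))).
assert (Hn : 0 < INR (p - 1)) by (apply (lt_INR 0); lia).
assert (HPI := PI_RGT_0); assert (HPI2 := PI2_1).
assert (H2PI : 0 < 2 / PI) by (apply Rdiv_lt_0_compat; lra).
assert (Hx : 0 < x) by apply exp_pos.
assert (Hxp : x ^ (p - 1) = 2 / PI).
{ rewrite <- Rpower_pow by exact Hx; unfold x.
  rewrite Rpower_mult, Rinv_l, Rpower_1; lra. }
apply (proj1 (Lub_Rbar_correct _)).
assert (Hx0 : RtoC x <> RtoC 0) by (intros E; injection E; lra).
exists (RtoC x); split; [|split; [exact Hx0|]].
- exists x; split; [|reflexivity]; split; [lra|].
  destruct (Rle_or_lt x 1) as [H|H]; [exact H|exfalso].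
  assert (H1 := Rlt_pow_R1 x (p - 1) H ltac:(lia)).
  rewrite Hxp in H1.
  apply (Rmult_lt_compat_r PI) in H1; [|lra].
  replace (2 / PI * PI) with 2 in H1 by (field; lra); lra.
- unfold sin_inv_pow; rewrite <- RtoC_pow, Hxp, <- RtoC_inv by lra.
  replace (/ (2 / PI)) with (PI / 2) by (field; lra).
  replace (Csin (RtoC (PI / 2))) with (RtoC 1); [now rewrite Cmod_1|].
  unfold Csin, Cexp; simpl.
  replace (0 * (PI / 2) - 1 * 0) with 0 by ring.
  replace (0 * 0 + 1 * (PI / 2)) with (PI / 2) by ring.
  rewrite Ropp_0, exp_0, cos_neg, sin_neg, cos_PI2, sin_PI2.
  unfold Cdiv, Cinv, Cmult, Cplus, Cminus, Copp, Ci, RtoC; simpl; f_equal; field.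
Qed.

(** Membership in [rho] bounds [Re z] and [Im z] separately, so with 0 it also
    contains [iy] for the half-height [y > 0] of the rectangle; but the cusp
    region contains no point of the imaginary axis other than 0. *)
Lemma rho_avoids_0 (A alpha beta : R) (p : nat) (gamma : R) :
  1 < A -> (0 < p)%nat -> alpha < beta ->
  (forall z, rho A alpha beta z -> cusp_region p gamma z) ->
  forall z, rho A alpha beta z -> z <> RtoC 0.
Proof.
intros HA Hp Hab Hsub z [Hz _] ->.
set (y := sqrt (A ^ 2 - 1) * ((beta - alpha) / 2)).
assert (Hy : 0 < y).
{ apply Rmult_lt_0_compat; [apply sqrt_lt_R0; nra|lra]. }
assert (H : rho A alpha beta (0, y)).
{ split; [exact Hz|]; simpl; rewrite Rabs_pos_eq; [apply Rle_refl|lra]. }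
apply Hsub in H; unfold cusp_region in H; simpl in H.
rewrite Rabs_R0, pow_i, Rabs_pos_eq in H by (lra || lia); lra.
Qed.

Theorem theorem24 (A : R) (hA : 1 < A) (p : nat) (hp : (1 < p)%nat)
    (c : R) (hc : 1 < c) :
  exists gamma : R, 0 < gamma /\
    Rbar_le (sup_mod punctured (sin_inv_pow p) (cusp_region p gamma))
      (Rbar_mult (Finite c) (sup_mod punctured (sin_inv_pow p) unit_segment)) /\
    (forall alpha beta : R, -1 <= alpha -> alpha < beta -> beta <= 1 ->
      (forall z : C, rho A alpha beta z -> cusp_region p gamma z) ->
      analytic_on punctured (sin_inv_pow p) (rho A alpha beta) /\
      Rbar_le (sup_mod punctured (sin_inv_pow p) (rho A alpha beta))
        (Rbar_mult (Finite c) (sup_mod punctured (sin_inv_pow p) unit_segment))).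
Proof.
assert (Hn : 0 < INR (p - 1)) by (apply (lt_INR 0); lia).
assert (Hln : 0 < ln c) by (rewrite <- ln_1; apply ln_increasing; lra).
assert (Hg : 0 < ln c / INR (p - 1)) by now apply Rdiv_lt_0_compat.
assert (Hc : Rbar_le c
  (Rbar_mult (Finite c) (sup_mod punctured (sin_inv_pow p) unit_segment))).
{ assert (H1 := sup_unit_segment_ge_1 p hp).
  destruct (sup_mod punctured (sin_inv_pow p) unit_segment) as [s| |].
  - simpl in *; nra.
  - replace (Rbar_mult c p_infty) with p_infty; [exact I|].
    symmetry; apply is_Rbar_mult_unique, is_Rbar_mult_sym.
    apply is_Rbar_mult_p_infty_pos; simpl; lra.
  - contradiction. }
assert (Hbound : forall z, cusp_region p (ln c / INR (p - 1)) z -> punctured z ->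
  Cmod (sin_inv_pow p z) <= c).
{ intros z Hz Hd.
  replace c with (exp (INR (p - 1) * (ln c / INR (p - 1)))).
  - apply Cmod_sin_inv_pow_le; auto; lra.
  - replace (INR (p - 1) * (ln c / INR (p - 1))) with (ln c) by (field; lra).
    apply exp_ln; lra. }
exists (ln c / INR (p - 1)); split; [exact Hg|split].
- apply Rbar_le_trans with (2 := Hc), sup_mod_le, Hbound.
- intros alpha beta _ Hab _ Hsub; split.
  + apply analytic_on_sin_inv_pow.
    apply rho_avoids_0 with (3 := Hab) (4 := Hsub); [exact hA|lia].
  + apply Rbar_le_trans with (2 := Hc), sup_mod_le.
    intros z Hz; now apply Hbound, Hsub.
Qed.
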